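(* Let $G$ be a graph on $n$ vertices, $G\ne K_n$. Then $G$ has a J-spherical representation, and it is unique up to isometry: if $f:V(G)\to\mathbb R^d$ and $f':V(G)\to\mathbb R^{d'}$ are J-spherical representations of $G$, then $d=d'$ and there is an isometry $\varphi$ of $\mathbb R^d$ with $f'=\varphi\circ f$.
   Context: All graphs are finite and simple; $K_n$ is the complete graph on $n$ vertices. A J-spherical representation of $G$ in $\mathbb R^d$ is an injective map $f:V(G)\to\mathbb R^d$ whose image affinely spans $\mathbb R^d$ and lies on the unit sphere $\mathbb S^{d-1}\subset\mathbb R^d$ centered at the origin, and for which there is a real number $b\ge\sqrt2$ such that $\|f(u)-f(v)\|=\sqrt2$ if $uv$ is an edge of $G$ and $\|f(u)-f(v)\|=b$ if $u\neq v$ and $uv$ is not an edge. *)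

(* Defs.v *)
From HB Require Import structures.
From mathcomp Require Import all_boot all_order all_algebra.
From mathcomp Require Import reals.

Set Implicit Arguments.
Unset Strict Implicit.
Unset Printing Implicit Defensive.

Import Order.TTheory GRing.Theory Num.Theory.
Local Open Scope ring_scope.

Record sgraph := SGraph {
  vertex :> finType;
  adj : rel vertex;
  adj_sym : symmetric adj;
  adj_irr : irreflexive adj }.

Definition graph_iso (G H : sgraph) : Prop :=
  exists2 h : G -> H, bijective h & forall u v, adj (h u) (h v) = adj u v.

Lemma neq_sym (n : nat) : symmetric (fun u v : 'I_n => u != v).
Proof. by move=> u v; rewrite eq_sym. Qed.

Lemma neq_irr (n : nat) : irreflexive (fun u v : 'I_n => u != v).
Proof. by move=> u; rewrite eqxx. Qed.

Definition complete_graph (n : nat) : sgraph :=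
  SGraph (@neq_sym n) (@neq_irr n).

(* The Euclidean norm; the norm that MathComp-Analysis puts on matrices is the
   sup norm. *)
Definition enorm (R : realType) (d : nat) (x : 'rV[R]_d) : R :=
  Num.sqrt (\sum_(i < d) x 0 i ^+ 2).

Definition euclidean_isometry (R : realType) (d : nat)
    (phi : 'rV[R]_d -> 'rV[R]_d) : Prop :=
  bijective phi /\ forall x y, enorm (phi x - phi y) = enorm (x - y).

(* Every point of R^d is an affine combination of the points f v. *)
Definition affinely_spans (R : realType) (V : finType) (d : nat)
    (f : V -> 'rV[R]_d) : Prop :=
  forall x : 'rV[R]_d,
    exists2 w : V -> R, \sum_v w v = 1 & x = \sum_v w v *: f v.

Definition J_spherical (R : realType) (G : sgraph) (d : nat)
    (f : G -> 'rV[R]_d) : Prop :=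
  [/\ injective f,
      affinely_spans f,
      forall v, enorm (f v) = 1
    & exists2 b : R, Num.sqrt 2 <= b
      & (forall u v, adj u v -> enorm (f u - f v) = Num.sqrt 2) /\
        (forall u v, u != v -> ~~ adj u v -> enorm (f u - f v) = b)].

(* Main.v *)
Require Import Defs.
From mathcomp Require Import all_boot all_order all_algebra.
From mathcomp Require Import ring lra.
From mathcomp Require Import classical_sets reals.

Set Implicit Arguments.
Unset Strict Implicit.
Unset Printing Implicit Defensive.

Import Order.TTheory GRing.Theory Num.Theory.
Local Open Scope ring_scope.

(** Let B be the adjacency matrix of the complement of G.  On the unit sphere,
    prescribing distances is prescribing inner products: distance sqrt 2 means
    orthogonal, and distance b >= sqrt 2 means inner product - t with
    t = b^2 / 2 - 1 >= 0.  So the Gram matrix of a J-spherical representation is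
    a member M_t = 1 - t B of a one-parameter pencil, and it is positive
    semidefinite.  Affine spanning says that the points span linearly and that,
    moreover, 0 is an affine combination of them, i.e. the left kernel of M_t
    contains a vector whose entries do not sum to 0 ([affinely_spansP]).  In
    particular M_t is singular.

    Uniqueness.  At most one t >= 0 makes M_t both positive semidefinite and
    singular: if w M_s = 0 with w != 0, then w B w^T > 0, so w M_t w^T < 0 for
    every t > s ([pencil_critical_le]).  Hence two representations have the same
    Gram matrix; its rank is the dimension, and equal Gram matrices of spanning
    families differ by an orthogonal matrix ([gram_dim], [gram_isometry]).

    Existence.  Since G is not complete, B is nonzero, the set of t >= 0 for
    which M_t is positive semidefinite is bounded, and its supremum T belongs to
    it.  M_T is singular, because an invertible positive semidefinite matrix
    remains so under a small perturbation ([pencil_critical]).  As in the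
    Perron-Frobenius theorem, taking absolute values in a kernel vector gives
    another kernel vector, now with positive sum ([pencil_Perron]).  A
    factorisation M_T = F F^T with F of full column rank ([psd_gram]) then gives
    the representation: the points are the rows of F. *)

(** * Positive semidefinite matrices and Gram factorisations *)

Section DotProduct.

Variable R : realType.

Definition dot n (x y : 'rV[R]_n) : R := (x *m y^T) 0 0.

Definition qform n (A : 'M[R]_n) (x : 'rV[R]_n) : R := dot (x *m A) x.

Definition psd n (A : 'M[R]_n) : Prop := forall x, 0 <= qform A x.

Lemma dotE n (x y : 'rV[R]_n) : dot x y = \sum_i x 0 i * y 0 i.
Proof. by rewrite /dot mxE; apply: eq_bigr => i _; rewrite mxE. Qed.

Lemma dotC n (x y : 'rV[R]_n) : dot x y = dot y x.
Proof. by rewrite !dotE; apply: eq_bigr => i _; rewrite mulrC. Qed.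

Lemma dotDl n (x y z : 'rV[R]_n) : dot (x + y) z = dot x z + dot y z.
Proof. by rewrite /dot mulmxDl mxE. Qed.

Lemma dotZl n a (x z : 'rV[R]_n) : dot (a *: x) z = a * dot x z.
Proof. by rewrite /dot -scalemxAl mxE. Qed.

Lemma dotBl n (x y z : 'rV[R]_n) : dot (x - y) z = dot x z - dot y z.
Proof. by rewrite dotDl -scaleN1r dotZl mulN1r. Qed.

Lemma dot_mulmx n m (x : 'rV[R]_m) (A : 'M[R]_(m, n)) (y : 'rV[R]_n) :
  dot (x *m A) y = dot x (y *m A^T).
Proof. by rewrite /dot trmx_mul trmxK mulmxA. Qed.

Lemma dot_ge0 n (x : 'rV[R]_n) : 0 <= dot x x.
Proof. by rewrite dotE sumr_ge0 // => i _; rewrite -expr2 sqr_ge0. Qed.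

Lemma dot_eq0 n (x : 'rV[R]_n) : dot x x = 0 -> x = 0.
Proof.
rewrite dotE => /eqP; rewrite psumr_eq0; last first.
  by move=> i _; rewrite -expr2 sqr_ge0.
move=> /allP h; apply/rowP => i; rewrite mxE.
by have := h i (mem_index_enum i); rewrite mulf_eq0 orbb => /eqP.
Qed.

Lemma dot_gt0 n (x : 'rV[R]_n) : x != 0 -> 0 < dot x x.
Proof.
move=> x0; rewrite lt_neqAle dot_ge0 andbT eq_sym.
by apply: contra_neq x0 => /dot_eq0.
Qed.

Lemma dot_sub n (x y : 'rV[R]_n) :
  dot (x - y) (x - y) = dot x x + dot y y - 2 * dot x y.
Proof.
by rewrite dotBl ![dot _ (x - y)]dotC !dotBl (dotC y x); ring.
Qed.

Lemma dot_AMGM n (x y : 'rV[R]_n) : 2 * dot x y <= dot x x + dot y y.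
Proof. by have := dot_ge0 (x - y); rewrite dot_sub; lra. Qed.

(** Nonnegativity of the squared norm of (y.y) x - (x.y) y, which is y.y times
    the difference of the two sides. *)
Lemma dot_CauchySchwarz n (x y : 'rV[R]_n) :
  dot x y ^+ 2 <= dot x x * dot y y.
Proof.
have [->|y0] := eqVneq y 0.
  by rewrite ![dot _ 0]dotC -(scale0r 0) !dotZl !mul0r expr0n /= mulr0.
have y_gt0 := dot_gt0 y0.
have := dot_ge0 (dot y y *: x - dot x y *: y).
rewrite dot_sub !dotZl ![dot _ (_ *: _)]dotC !dotZl (dotC y x).
have -> : dot y y * (dot y y * dot x x) + dot x y * (dot x y * dot y y)
  - 2 * (dot y y * (dot x y * dot x y))
  = dot y y * (dot x x * dot y y - dot x y ^+ 2) by ring.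
by rewrite pmulr_rge0 // subr_ge0.
Qed.

(** The squared Frobenius norm would do for the constant; adding 1 makes it
    positive, hence invertible, even when A = 0. *)
Lemma dot_mulmx_bounded m n (A : 'M[R]_(m, n)) :
  exists2 C, 0 < C & forall x, dot (x *m A) (x *m A) <= C * dot x x.
Proof.
exists (1 + \sum_j dot (col j A)^T (col j A)^T).
  by rewrite ltr_wpDr // sumr_ge0 // => j _; apply: dot_ge0.
move=> x; rewrite mulrDl mul1r.
apply: le_trans (_ : _ <= 0 + _) _; last by apply: lerD; rewrite ?dot_ge0.
rewrite add0r [leLHS]dotE mulr_suml ler_sum // => j _.
rewrite -expr2.
have -> : (x *m A) 0 j = dot (col j A)^T x.
  by rewrite dotE mxE; apply: eq_bigr => k _; rewrite !mxE mulrC.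
exact: dot_CauchySchwarz.
Qed.

Lemma qform_gram n m (F : 'M[R]_(n, m)) x :
  qform (F *m F^T) x = dot (x *m F) (x *m F).
Proof. by rewrite /qform mulmxA dot_mulmx trmxK. Qed.

Lemma qformB n (A B : 'M[R]_n) x t :
  qform (A - t *: B) x = qform A x - t * qform B x.
Proof. by rewrite /qform mulmxBr dotBl -scalemxAr dotZl. Qed.

(** Induction on the size, splitting off the first row.  If the corner a is
    positive, complete the square: the Schur complement D = C - b^T b / a is
    again positive semidefinite, and a factor of D extends by the column
    (sqrt a, b^T / sqrt a).  If a = 0, positivity forces the whole first row to
    vanish, and the factor of C extends by a zero row, without a new column.
    The left inverse L records that F has full column rank, so that the rows of
    F span the whole space. *)
Lemma psd_gram n (A : 'M[R]_n) : A^T = A -> psd A ->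
  exists (d : nat) (F : 'M[R]_(n, d)) (L : 'M[R]_(d, n)),
    F *m F^T = A /\ L *m F = 1%:M.
Proof.
elim: n A => [|n IHn] A symA psdA.
  by exists 0%N, 0, 0; split; apply/matrixP => [[]].
rewrite -[n.+1]/(1 + n)%N in A symA psdA *.
pose a : R := ulsubmx A 0 0; pose b := ursubmx A; pose C := drsubmx A.
have defA : A = block_mx a%:M b b^T C.
  rewrite -[LHS]submxK -/b -/C [ulsubmx A]mx11_scalar -/a.
  by congr block_mx; rewrite /b trmx_ursub symA.
have symC : C^T = C by rewrite /C trmx_drsub symA.
have qA (s : R) (y : 'rV_n) :
  qform A (row_mx s%:M y) = s ^+ 2 * a + 2 * s * dot b y + qform C y.
  rewrite defA /qform mul_row_block /dot tr_row_mx mul_row_col.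
  rewrite tr_scalar_mx !mulmxDl -/b -!mulmxA !mul_scalar_mx mul_mx_scalar.
  rewrite -scalemxAr ![(_ + _ : 'M_1) 0 0]mxE.
  rewrite ![(_ *: _ : 'M_1) 0 0]mxE [_%:M 0 0]mxE.
  rewrite -/(dot y b) (dotC y b) /dot eqxx mulr1n; ring.
have psdC : psd C.
  move=> y; have := psdA (row_mx 0%:M y).
  by rewrite qA expr0n /= !(mul0r, mulr0) !add0r.
have a_ge0 : 0 <= a.
  have := psdA (row_mx 1%:M 0); rewrite qA /qform mul0mx /dot trmx0 !mulmx0 !mxE.
  by rewrite expr1n mul1r mulr0 !addr0.
have [a0|a_neq0] := eqVneq a 0.
  have b0 : b = 0.
    apply/eqP/negPn/negP => /dot_gt0 b_gt0.
    (* With a zero corner the form is affine in the first coordinate, with slope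
       2 b.b; this coordinate makes its value - q - 2, where q = b C b^T >= 0. *)
    have := psdA (row_mx (- ((qform C b + 1) / dot b b))%:M b).
    rewrite qA a0 mulr0 add0r mulrN mulNr mulrA mulfVK ?gt_eqF //.
    by have := psdC b; lra.
  have [d [F [L [FC LF]]]] := IHn C symC psdC.
  exists d, (col_mx 0 F), (row_mx 0 L); split.
    by rewrite tr_col_mx mul_col_row trmx0 !mul0mx mulmx0 FC
         defA a0 b0 trmx0 raddf0.
  by rewrite mul_row_col mul0mx add0r.
have a_gt0 : 0 < a by rewrite lt_neqAle eq_sym a_neq0.
pose r := Num.sqrt a.
have r_neq0 : r != 0 by rewrite gt_eqF // sqrtr_gt0.
have r2 : r * r = a by rewrite -expr2 sqr_sqrtr.
pose D := C - a^-1 *: (b^T *m b).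
have symD : D^T = D.
  by rewrite /D linearB linearZ /= trmx_mul trmxK symC.
have psdD : psd D.
  (* The first coordinate minimising the form for a given y. *)
  move=> y; have := psdA (row_mx (- (a^-1 * dot b y))%:M y); rewrite qA.
  have qbb := qform_gram b^T y; rewrite trmxK in qbb.
  rewrite /D qformB qbb.
  have -> : dot (y *m b^T) (y *m b^T) = dot b y ^+ 2.
    by rewrite [LHS]dotE big_ord1 -expr2 dotC.
  by congr (_ <= _); field.
have [d [F [L [FD LF]]]] := IHn D symD psdD.
exists (1 + d)%N, (block_mx r%:M 0 (r^-1 *: b^T) F).
exists (block_mx r^-1%:M 0 (- a^-1 *: (L *m b^T)) L); split.
  rewrite tr_block_mx mulmx_block defA trmx0 !tr_scalar_mx.
  rewrite !linearZ /= !trmxK !mul0mx !mulmx0 !addr0 mul_scalar_mx mul_mx_scalar.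
  rewrite !scalerA divff // !scale1r scale_scalar_mx r2 -scalemxAl scalerA.
  rewrite -invfM r2 FD /D addrC subrK.
  by rewrite mul_scalar_mx scalerA mulVf // scale1r.
rewrite mulmx_block !mul0mx !mulmx0 !addr0 !add0r -scalar_mxM mulVf // LF.
rewrite mul_mx_scalar -scalemxAr scalerA mulrN -r2 invfM mulrA divff // mul1r.
by rewrite scaleNr addNr -scalar_mx_block.
Qed.

(** Invertibility makes the form coercive: if A = F F^T, then x is recovered
    from x F as (x F) (F^T A^-1), so x.x <= c (x A x^T) for some c.  The form of
    B is at most a multiple of x.x, so a small multiple of it is dominated. *)
Lemma psd_perturb n (A B : 'M[R]_n) :
    A^T = A -> psd A -> A \in unitmx ->
  exists2 e, 0 < e & psd (A - e *: B).
Proof.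
move=> symA psdA unitA.
have [d [F [_ [FA _]]]] := psd_gram symA psdA.
have [c c_gt0 boundF] := dot_mulmx_bounded (F^T *m invmx A).
have [k k_gt0 boundB] := dot_mulmx_bounded B.
have ck_gt0 : 0 < c * (k + 1) by rewrite mulr_gt0 // addr_gt0.
exists (c * (k + 1))^-1; first by rewrite invr_gt0.
move=> x; rewrite qformB subr_ge0 ler_pdivrMl // -FA qform_gram.
have := boundF (x *m F).
rewrite -mulmxA (mulmxA F) FA mulmxV // mulmx1 => x_le.
have qB : 2 * qform B x <= (k + 1) * dot x x.
  rewrite [leRHS]mulrDl mul1r /qform.
  by apply: le_trans (dot_AMGM _ _) _; rewrite lerD2r boundB.
have : (k + 1) * dot x x <= (k + 1) * (c * dot (x *m F) (x *m F)).
  by rewrite ler_pM2l // addr_gt0.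
have : 0 <= (k + 1) * dot x x by rewrite mulr_ge0 ?dot_ge0 // addr_ge0 // ltW.
rewrite mulrA (mulrC _ c); lra.
Qed.

(** * The pencil 1 - t B *)

(** The parameter is the supremum of those t >= 0 for which the form is positive
    semidefinite.  Each x with x B x^T > 0 imposes t <= x.x / (x B x^T) and the
    other x impose nothing, so the supremum is attained; by [psd_perturb] it
    could be exceeded if the matrix were invertible there. *)
Lemma pencil_critical n (B : 'M[R]_n) :
    B^T = B -> (exists x, 0 < qform B x) ->
  exists t, [/\ 0 <= t, psd (1%:M - t *: B) & 1%:M - t *: B \notin unitmx].
Proof.
move=> symB [x0 q0].
have q1 x : qform 1%:M x = dot x x by rewrite /qform mulmx1.
pose S : set R := [set t | 0 <= t /\ psd (1%:M - t *: B)]%classic.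
have S0 : S 0.
  by split=> // x; rewrite qformB mul0r subr0 q1 dot_ge0.
have supS : has_sup S.
  split; first by exists 0.
  exists (dot x0 x0 / qform B x0) => t [_ /(_ x0)].
  by rewrite qformB q1 subr_ge0 ler_pdivlMr.
have supS_ge0 : 0 <= sup S by apply: ub_le_sup S0; case: supS.
have psdT : psd (1%:M - sup S *: B).
  move=> x; rewrite qformB q1 subr_ge0.
  have [q_gt0|q_le0] := ltP 0 (qform B x); last first.
    by apply: le_trans (dot_ge0 x); rewrite mulr_ge0_le0.
  rewrite -ler_pdivlMr //; apply: ge_sup; first by exists 0.
  by move=> t [_ /(_ x)]; rewrite qformB q1 subr_ge0 ler_pdivlMr.
exists (sup S); split=> //; apply/negP => unitT.
have symT : (1%:M - sup S *: B)^T = 1%:M - sup S *: B.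
  by rewrite linearB linearZ /= tr_scalar_mx symB.
have [e e_gt0 psdTe] := psd_perturb B symT psdT unitT.
have : S (sup S + e).
  by split; [rewrite addr_ge0 // ltW | rewrite scalerDl opprD addrA].
move/(ub_le_sup supS.2); lra.
Qed.

(** Replacing the entries of a kernel vector w by their absolute values keeps
    w.w and does not decrease w B w^T, as B is nonnegative.  So the form remains
    zero, and a zero of a positive semidefinite form is a kernel vector. *)
Lemma pencil_Perron n (B : 'M[R]_n) t :
    B^T = B -> (forall i j, 0 <= B i j) -> 0 <= t -> psd (1%:M - t *: B) ->
    1%:M - t *: B \notin unitmx ->
  exists2 v : 'rV_n, v *m (1%:M - t *: B) = 0 & 0 < \sum_i v 0 i.
Proof.
move=> symB B_ge0 t_ge0 psdM; set M := 1%:M - t *: B in psdM *.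
rewrite unitmxE unitfE negbK => /det0P[w w_neq0 wM].
have symM : M^T = M by rewrite linearB linearZ /= tr_scalar_mx symB.
have [d [F [_ [FM _]]]] := psd_gram symM psdM.
pose v : 'rV_n := map_mx Num.norm w.
exists v.
  suff vF : v *m F = 0 by rewrite -FM mulmxA vF mul0mx.
  apply: dot_eq0; apply/eqP; rewrite eq_le dot_ge0 andbT -qform_gram FM.
  have <- : qform M w = 0.
    by rewrite /qform wM dotE big1 // => i _; rewrite mxE mul0r.
  rewrite !qformB lerB //.
    rewrite /qform !mulmx1 !dotE ler_sum // => i _.
    by rewrite !mxE -normrM ger0_norm // -expr2 sqr_ge0.
  rewrite ler_wpM2l // /qform !dotE ler_sum // => i _.
  rewrite !mxE; apply: le_trans (ler_norm _) _; rewrite normrM ler_wpM2r //.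
  apply: le_trans (ler_norm_sum _ _ _) _; apply: ler_sum => j _.
  by rewrite !mxE normrM [`|B _ _|]ger0_norm.
have [i wi] : exists i, w 0 i != 0 by apply/rV0Pn.
rewrite (bigD1 i) //= ltr_pwDl ?mxE ?normr_gt0 //.
by apply: sumr_ge0 => j _; rewrite mxE.
Qed.

(** The kernel vector w satisfies w.w = s (w B w^T), so the form of 1 - t B at w
    is (s - t) (w B w^T), where w B w^T > 0. *)
Lemma pencil_critical_le n (B : 'M[R]_n) (w : 'rV_n) s t :
    w != 0 -> w *m (1%:M - s *: B) = 0 -> 0 <= s -> psd (1%:M - t *: B) ->
  t <= s.
Proof.
move=> /dot_gt0 w_gt0 wM s_ge0 /(_ w); rewrite qformB /qform mulmx1 -/(qform B w).
have : qform (1%:M - s *: B) w = 0.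
  by rewrite /qform wM dotE big1 // => i _; rewrite mxE mul0r.
rewrite qformB /qform mulmx1 -/(qform B w) => /subr0_eq w_sB.
rewrite w_sB in w_gt0 *.
have q_gt0 : 0 < qform B w.
  by rewrite ltNge; apply: contraTN w_gt0 => q_le0; rewrite -leNgt mulr_ge0_le0.
by rewrite subr_ge0 ler_pM2r.
Qed.

(** * Families of vectors with the same Gram matrix *)

Lemma gram_dim d d' n (F : 'M[R]_(n, d)) (F' : 'M_(n, d')) :
  row_full F -> row_full F' -> F *m F^T = F' *m F'^T -> d = d'.
Proof.
have rank_gram m (H : 'M[R]_(n, m)) : row_full H -> \rank (H *m H^T) = m.
  move=> fullH; rewrite mxrankMfree; first exact: (eqP fullH).
  by rewrite /row_free mxrank_tr.
by move=> fF fF' eqF; rewrite -(rank_gram _ F) // eqF rank_gram.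
Qed.

(** Q expresses F' in the coordinates that a left inverse L of F provides.  That
    F Q = F L F' is F' may be tested after multiplication by F'^T, which is right
    invertible; there F' F'^T = F F^T and L F = 1. *)
Lemma gram_isometry d n (F F' : 'M[R]_(n, d)) :
    row_full F -> row_full F' -> F *m F^T = F' *m F'^T ->
  exists2 Q : 'M_d, Q *m Q^T = 1%:M & F *m Q = F'.
Proof.
move=> /row_fullP[L LF] /row_fullP[L' LF'] eqF.
exists (L *m F').
  by rewrite trmx_mul mulmxA -(mulmxA L) -eqF mulmxA LF mul1mx -trmx_mul LF trmx1.
have L'F : F'^T *m L'^T = 1%:M by rewrite -trmx_mul LF' trmx1.
rewrite -[RHS]mulmx1 -[LHS]mulmx1 -L'F !mulmxA; congr (_ *m _).
by rewrite -!mulmxA -eqF (mulmxA L) LF mul1mx.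
Qed.

End DotProduct.

(** * Gram matrices of J-spherical representations *)

Section Representations.

Variables (R : realType) (G : sgraph).

Definition non_edge (u v : G) : bool := (u != v) && ~~ adj u v.

Definition coadj_mx : 'M[R]_#|G| :=
  \matrix_(i, j) (non_edge (enum_val i) (enum_val j))%:R.

Lemma non_edge_sym : symmetric non_edge.
Proof. by move=> u v; rewrite /non_edge eq_sym adj_sym. Qed.

Lemma coadj_sym : coadj_mx^T = coadj_mx.
Proof. by apply/matrixP => i j; rewrite !mxE non_edge_sym. Qed.

Lemma not_complete_non_edge :
  ~ graph_iso G (complete_graph #|G|) -> exists u v, non_edge u v.
Proof.
move=> notK; have [/existsP[u /existsP[v uv]]|h] :=
  boolP [exists u, exists v, non_edge u v]; first by exists u, v.
case: notK; exists enum_rank; first exact: enum_rank_bij.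
move=> u v /=; rewrite (inj_eq enum_rank_inj).
move: h; rewrite negb_exists => /forallP/(_ u); rewrite negb_exists.
move=> /forallP/(_ v); rewrite negb_and negbK.
by have [->|_] := eqVneq u v; [rewrite adj_irr | move=> /= /negPn->].
Qed.

(** At the all-ones vector the form counts the ordered pairs of non-adjacent
    vertices. *)
Lemma qform_coadj_gt0 u v : non_edge u v -> exists x, 0 < qform coadj_mx x.
Proof.
move=> uv; pose x : 'rV[R]_#|G| := const_mx 1.
have colE i : (x *m coadj_mx) 0 i * x 0 i = \sum_j coadj_mx j i.
  by rewrite !mxE mulr1; apply: eq_bigr => j _; rewrite !mxE mul1r.
exists x; rewrite /qform dotE (eq_bigr _ (fun i _ => colE i)).
rewrite (bigD1 (enum_rank v)) //= (bigD1 (enum_rank u)) //=.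
rewrite [coadj_mx _ _]mxE !enum_rankK uv -addrA ltr_pwDl // addr_ge0 //.
  by apply: sumr_ge0 => i _; rewrite mxE.
by apply: sumr_ge0 => i _; apply: sumr_ge0 => j _; rewrite mxE.
Qed.

Lemma enormE d (x : 'rV[R]_d) : enorm x = Num.sqrt (dot x x).
Proof. by rewrite /enorm dotE; under eq_bigr do rewrite expr2. Qed.

Lemma enorm_sqr d (x : 'rV[R]_d) : enorm x ^+ 2 = dot x x.
Proof. by rewrite enormE sqr_sqrtr // dot_ge0. Qed.

Definition point_mx d (f : G -> 'rV[R]_d) : 'M[R]_(#|G|, d) :=
  \matrix_i f (enum_val i).

Lemma mul_point_mx d (f : G -> 'rV[R]_d) (w : 'rV_#|G|) :
  w *m point_mx f = \sum_v w 0 (enum_rank v) *: f v.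
Proof.
rewrite mulmx_sum_row (reindex enum_rank); last exact: onW_bij (enum_rank_bij _).
by apply: eq_bigr => v _; rewrite rowK enum_rankK.
Qed.

Lemma sum_enum_rank (w : 'rV[R]_#|G|) : \sum_i w 0 i = \sum_v w 0 (enum_rank v).
Proof. by rewrite (reindex enum_rank) //; exact: onW_bij (enum_rank_bij _). Qed.

(** For the converse, a point is first written as a linear combination; a
    multiple of w then corrects the sum of the coefficients to 1 without moving
    the point. *)
Lemma affinely_spansP d (f : G -> 'rV[R]_d) :
  affinely_spans f <->
  row_full (point_mx f) /\
  exists2 w : 'rV_#|G|, w *m point_mx f = 0 & \sum_i w 0 i = 1.
Proof.
split=> [span|[/row_fullP[L LF] [w wF w1]] x].
  have row_of x : exists2 w : 'rV_#|G|, w *m point_mx f = x & \sum_i w 0 i = 1.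
    have [w w1 ->] := span x; exists (\row_i w (enum_val i)).
      by rewrite mul_point_mx; apply: eq_bigr => v _; rewrite mxE enum_rankK.
    by rewrite sum_enum_rank -w1; apply: eq_bigr => v _; rewrite mxE enum_rankK.
  split; last exact: row_of.
  rewrite -sub1mx; apply/row_subP => i.
  by have [w <- _] := row_of (row i 1%:M); apply: submxMl.
have [c cF] : exists c, c *m point_mx f = x.
  by exists (x *m L); rewrite -mulmxA LF mulmx1.
pose w' := c + (1 - \sum_i c 0 i) *: w.
exists (fun v => w' 0 (enum_rank v)).
  rewrite -sum_enum_rank /w'; under eq_bigr do rewrite !mxE.
  by rewrite big_split /= -mulr_sumr w1 mulr1 subrKC.
by rewrite -mul_point_mx mulmxDl -scalemxAl wF scaler0 addr0 cF.
Qed.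

Lemma gram_pointE d (f : G -> 'rV[R]_d) i j :
  (point_mx f *m (point_mx f)^T) i j = dot (f (enum_val i)) (f (enum_val j)).
Proof. by rewrite dotE mxE; apply: eq_bigr => k _; rewrite !mxE. Qed.

Lemma J_spherical_gram d (f : G -> 'rV[R]_d) : J_spherical f ->
  exists2 t, 0 <= t & point_mx f *m (point_mx f)^T = 1%:M - t *: coadj_mx.
Proof.
case=> _ _ norm1 [b b_ge [adjE nadjE]].
have sqrt2 : Num.sqrt 2 ^+ 2 = 2 :> R by rewrite sqr_sqrtr.
have b2 : 2 <= b ^+ 2.
  by rewrite -[leLHS]sqrt2 ler_sqr // nnegrE ?(le_trans _ b_ge) // sqrtr_ge0.
have dot1 v : dot (f v) (f v) = 1 by rewrite -enorm_sqr norm1 expr1n.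
have dist u v : enorm (f u - f v) ^+ 2 = 2 - 2 * dot (f u) (f v).
  by rewrite enorm_sqr dot_sub !dot1.
exists (b ^+ 2 / 2 - 1); first by lra.
apply/matrixP => i j; rewrite gram_pointE !mxE.
have [<-|ij] := eqVneq i j.
  by rewrite /non_edge eqxx mulr0 subr0 dot1.
have uv : enum_val i != enum_val j by rewrite (inj_eq enum_val_inj).
have := dist (enum_val i) (enum_val j); rewrite /non_edge uv /=.
have [Euv|nEuv] := boolP (adj _ _).
  by rewrite adjE // sqrt2 /= => h; lra.
by rewrite nadjE //= => h; lra.
Qed.

(** Injectivity comes for free: distinct vertices are sent to points at distance
    at least sqrt 2. *)
Lemma gram_J_spherical d (f : G -> 'rV[R]_d) t :
    0 <= t -> point_mx f *m (point_mx f)^T = 1%:M - t *: coadj_mx ->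
    affinely_spans f ->
  J_spherical f.
Proof.
move=> t_ge0 gram span.
have dotf u v : dot (f u) (f v) = (u == v)%:R - t * (non_edge u v)%:R.
  have := gram_pointE f (enum_rank u) (enum_rank v).
  by rewrite !enum_rankK gram !mxE !enum_rankK (inj_eq enum_rank_inj).
have dot1 v : dot (f v) (f v) = 1.
  by rewrite dotf /non_edge eqxx mulr0 subr0.
have dist u v : u != v ->
    enorm (f u - f v) = Num.sqrt (2 + 2 * t * (non_edge u v)%:R).
  move=> uv; rewrite enormE dot_sub !dot1 dotf (negPf uv) sub0r.
  by congr Num.sqrt; ring.
split=> //.
- move=> u v fuv; apply/eqP/negPn/negP => /dist/eqP.
  rewrite fuv subrr enormE dotE big1 => [|i _]; last by rewrite mxE mul0r.
  rewrite sqrtr0 eq_sym sqrtr_eq0 leNgt => /negP; apply.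
  by rewrite ltr_pwDl // !mulr_ge0.
- by move=> v; rewrite enormE dot1 sqrtr1.
exists (Num.sqrt (2 + 2 * t)); first by rewrite ler_sqrt; lra.
split=> [u v Euv|u v uv nEuv].
  have uv : u != v by apply: contraTneq Euv => ->; rewrite adj_irr.
  by rewrite dist // /non_edge Euv andbF mulr0 addr0.
by rewrite dist // /non_edge uv nEuv mulr1.
Qed.

Lemma J_spherical_exists u v : non_edge u v ->
  exists d (f : G -> 'rV[R]_d), J_spherical f.
Proof.
move=> uv.
have [t [t_ge0 psdM singM]] := pencil_critical coadj_sym (qform_coadj_gt0 uv).
have B_ge0 i j : 0 <= coadj_mx i j by rewrite mxE.
have [w wM w_gt0] := pencil_Perron coadj_sym B_ge0 t_ge0 psdM singM.
have symM : (1%:M - t *: coadj_mx)^T = 1%:M - t *: coadj_mx.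
  by rewrite linearB linearZ /= tr_scalar_mx coadj_sym.
have [d [F [L [FM LF]]]] := psd_gram symM psdM.
pose f v := row (enum_rank v) F.
have fF : point_mx f = F.
  by apply/row_matrixP => i; rewrite rowK /f enum_valK.
exists d, f; apply: (gram_J_spherical t_ge0); first by rewrite fF.
apply/affinely_spansP; rewrite fF; split; first by apply/row_fullP; exists L.
exists ((\sum_i w 0 i)^-1 *: w).
  suff wF : w *m F = 0 by rewrite -scalemxAl wF scaler0.
  by apply: dot_eq0; rewrite -qform_gram FM /qform wM /dot mul0mx mxE.
under eq_bigr do rewrite mxE.
by rewrite -mulr_sumr mulVf // gt_eqF.
Qed.

(** Both Gram matrices are positive semidefinite and singular members of the
    pencil, so each parameter bounds the other by [pencil_critical_le]. *)
Lemma J_spherical_gram_unique d d' (f : G -> 'rV[R]_d) (f' : G -> 'rV[R]_d') :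
    J_spherical f -> J_spherical f' ->
  point_mx f *m (point_mx f)^T = point_mx f' *m (point_mx f')^T.
Proof.
have singular m (g : G -> 'rV[R]_m) : J_spherical g ->
    exists2 w : 'rV_#|G|, w != 0 & w *m (point_mx g *m (point_mx g)^T) = 0.
  case=> _ /affinely_spansP[_ [w wF w1]] _ _; exists w.
    apply: contra_eq_neq w1 => ->; rewrite big1 => [|i _]; last by rewrite mxE.
    by rewrite eq_sym oner_eq0.
  by rewrite mulmxA wF mul0mx.
have psdF m (g : G -> 'rV[R]_m) : psd (point_mx g *m (point_mx g)^T).
  by move=> x; rewrite qform_gram dot_ge0.
move=> Jf Jf'.
have [[w w0 wM] [w' w'0 wM']] := (singular _ _ Jf, singular _ _ Jf').
have [psdM psdM'] := (psdF _ f, psdF _ f').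
have [t t_ge0 gram] := J_spherical_gram Jf.
have [t' t'_ge0 gram'] := J_spherical_gram Jf'.
rewrite gram gram' in wM wM' psdM psdM' *.
suff -> : t = t' by [].
apply: le_anti; rewrite (pencil_critical_le w0 wM) // andbT.
exact: pencil_critical_le w'0 wM' _ _.
Qed.

End Representations.

(** * Existence and uniqueness *)

Lemma orthogonal_isometry (R : realType) d (Q : 'M[R]_d) :
  Q *m Q^T = 1%:M -> euclidean_isometry (mulmxr Q : 'rV_d -> 'rV_d).
Proof.
move=> QQ; split.
  exists (mulmxr Q^T) => x /=; first by rewrite -mulmxA QQ mulmx1.
  by rewrite -mulmxA (mulmx1C QQ) mulmx1.
by move=> x y; rewrite !enormE /= -mulmxBl dot_mulmx -mulmxA QQ mulmx1.
Qed.

Theorem corollary4p1 (R : realType) (n : nat) (G : sgraph)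
    (G_order : #|G| = n) (G_not_complete : ~ graph_iso G (complete_graph n)) :
  (exists (d : nat) (f : G -> 'rV[R]_d), J_spherical f) /\
  (forall (d d' : nat) (f : G -> 'rV[R]_d) (f' : G -> 'rV[R]_d'),
     J_spherical f -> J_spherical f' ->
     exists (dd' : d = d') (phi : 'rV[R]_d -> 'rV[R]_d),
       euclidean_isometry phi /\ forall v, f' v = castmx (erefl 1%N, dd') (phi (f v))).
Proof.
subst n; split.
  by have [u [v]] := not_complete_non_edge G_not_complete; apply: J_spherical_exists.
move=> d d' f f' Jf Jf'.
have gram := J_spherical_gram_unique Jf Jf'.
have [_ /affinely_spansP[fullF _] _ _] := Jf.
have [_ /affinely_spansP[fullF' _] _ _] := Jf'.
have dd' := gram_dim fullF fullF' gram; subst d'.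
have [Q QQ FQ] := gram_isometry fullF fullF' gram.
exists erefl, (mulmxr Q); split; first exact: orthogonal_isometry.
move=> v; rewrite castmx_id /=.
have := congr1 (row (enum_rank v)) FQ.
by rewrite row_mul !rowK !enum_rankK.
Qed.
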